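(* Let $(\mathrm{X},\Sigma,\mu)$ be a measure space and $p\in[1,\infty)$. Let $(f_n)$ be a sequence in $\Lambda_p(\mathrm{X})$ and let $f$ be a measurable function. Assume that $(f_n)$ converges to $f$ almost everywhere and that there exists $g\in\Lambda_p(\mathrm{X})$ such that $\sup_n|f_n|\le g$ almost everywhere. Then $f\in\Lambda_p(\mathrm{X})$ and $\|f_n-f\|_{\alpha_p}\to0$ as $n\to\infty$.
   Context: Measurable functions are real-valued and identified $\mu$-a.e.; $L_0(\mathrm{X})$ denotes the space of such functions and $L_p(\mathrm{X})$ the usual Lebesgue space with norm $\|\cdot\|_p$. $\Lambda_p(\mathrm{X})$ is the set of $f\in L_0(\mathrm{X})$ such that for every $\delta>0$ there exists $E_\delta\in\Sigma$ with $\mu(E_\delta)<\delta$ and $f\chi_{E_\delta^c}\in L_p(\mathrm{X})$. For a measurable function $f$, $\|f\|_{\alpha_p}=\|\min(|f|,1)\|_p$. *)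

(* Defs.v *)
From HB Require Import structures.
From mathcomp Require Import all_boot all_order all_algebra.
From mathcomp Require Import all_classical all_reals all_analysis.
Import Order.TTheory GRing.Theory Num.Theory.
Import numFieldNormedType.Exports.

Set Implicit Arguments.
Unset Strict Implicit.
Unset Printing Implicit Defensive.

Local Open Scope classical_set_scope.
Local Open Scope ring_scope.

(* An element of L_0 is given by a measurable representative; both notions
   below depend only on the mu-a.e. class of that representative. *)

Definition Lambda d (X : measurableType d) (R : realType)
    (mu : {measure set X -> \bar R}) (p : R) : set {mfun X >-> R} :=
  [set f | forall delta : R, 0 < delta ->
     exists E : set X, [/\ measurable E, (mu E < delta%:E)%E
       & (fun x => f x * \1_(~` E) x) \in Lfun mu p%:E]].

(* Valued in [\bar R]: it is [+oo] when [min(|f|, 1)] is not in L_p. *)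
Definition alpha_norm d (X : measurableType d) (R : realType)
    (mu : {measure set X -> \bar R}) (p : R) (f : X -> R) : \bar R :=
  'N[mu]_p%:E[(fun x => (Num.min `|f x| 1)%:E)]%E.

(* Main.v *)
(** Since [f] is an almost everywhere limit, [|f| <= |g|] almost everywhere, so
    the exceptional sets of [g] also serve for [f].  With [E] the exceptional
    set of [g] for [delta = 1], [min(|g|, 1)^p <= 1_E + |g 1_(~E)|^p] is
    integrable, and [min(|f_n - f|, 1) <= 2 min(|g|, 1)]; dominated convergence
    for the [p]-th powers concludes. *)
Require Import Defs.
From HB Require Import structures.
From mathcomp Require Import all_boot all_order all_algebra.
From mathcomp Require Import all_classical all_reals all_analysis.
From mathcomp Require Import measurable_realfun.
From mathcomp Require Import lra.
Import Order.TTheory GRing.Theory Num.Theory.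
Import numFieldNormedType.Exports.

Local Open Scope classical_set_scope.
Local Open Scope ring_scope.

Lemma measurable_norm_powR {R : realType} {d : measure_display}
    {X : measurableType d} (p : R) {f : X -> R} :
  measurable_fun [set: X] f -> measurable_fun [set: X] (fun x => `|f x| `^ p).
Proof.
move=> mf; apply: (measurableT_comp (measurable_powR _)).
exact: measurableT_comp.
Qed.

(** Monotonicity of the integral bounds the integral of [|f|^p] by that of [|g|^p]; the [p]-norm, a
    power of this integral, is then finite. *)
Lemma Lfun_ae_le {R : realType} {d : measure_display} {X : measurableType d}
    {mu : {measure set X -> \bar R}} {p : R} {f g : X -> R} :
  1 <= p -> measurable_fun [set: X] f ->
  {ae mu, forall x, `|f x| <= `|g x|} ->
  g \in Lfun mu p%:E -> f \in Lfun mu p%:E.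
Proof.
move=> p1 mf fg gp; have p0 : 0 <= p by exact: le_trans p1.
have /integrableP[mgp] := Lfun_integrable p1 gp.
under eq_integral => x _ do rewrite gee0_abs ?lee_fin ?powR_ge0//.
move=> gfin; rewrite inE; apply/andP; split; rewrite inE//=.
rewrite /finite_norm unlock poweR_lty//; apply: le_lt_trans gfin.
apply: ae_ge0_le_integral => //.
- by move=> x _; rewrite poweR_ge0.
- by have /measurable_EFinP := measurable_norm_powR p mf.
- apply: filterS fg => x fgx _ /=; rewrite lee_fin.
  by apply: ge0_ler_powR => //; rewrite nnegrE.
Qed.

Lemma Lambda_ae_le {R : realType} {d : measure_display} {X : measurableType d}
    {mu : {measure set X -> \bar R}} {p : R} {f g : {mfun X >-> R}} :
  1 <= p -> {ae mu, forall x, `|f x| <= `|g x|} ->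
  Lambda mu p g -> Lambda mu p f.
Proof.
move=> p1 fg Lg delta d0; have [E [mE Ed gE]] := Lg _ d0.
exists E; split => //; apply: (Lfun_ae_le p1) gE.
  by apply: measurable_funM => //; apply: measurable_indic; exact: measurableC.
by apply: filterS fg => x fgx; rewrite !normrM ler_wpM2r.
Qed.

Lemma Lambda_integrable_min1 {R : realType} {d : measure_display}
    {X : measurableType d} {mu : {measure set X -> \bar R}} {p : R}
    {g : {mfun X >-> R}} :
  1 <= p -> Lambda mu p g ->
  mu.-integrable [set: X] (fun x => (Num.min `|g x| 1 `^ p)%:E).
Proof.
move=> p1 Lg; have [E [mE E1 gE]] := Lg _ ltr01.
have p0 : 0 <= p by exact: le_trans p1.
have iE : mu.-integrable [set: X] (fun x => (\1_E x)%:E : \bar R).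
  apply/integrableP; split; first exact/measurable_EFinP/measurable_indic.
  under eq_integral => x _ do rewrite gee0_abs ?lee_fin//.
  by rewrite integral_indic// setIT (lt_trans E1)// ltry.
apply: le_integrable (integrableD measurableT iE (Lfun_integrable p1 gE)) => //.
  apply/measurable_EFinP/(measurableT_comp (measurable_powR _)).
  by apply: measurable_minr => //; exact: measurableT_comp.
move=> x _ /=; rewrite lee_fin [leLHS]ger0_norm ?powR_ge0//.
rewrite [leRHS]ger0_norm ?addr_ge0 ?powR_ge0//.
have m0 : 0 <= Num.min `|g x| 1 by rewrite le_min normr_ge0 ler01.
rewrite !indicE in_setC; case: (x \in E) => /=.
  rewrite ler_wpDr ?powR_ge0// (_ : true%:R = 1 `^ p); last by rewrite powR1.
  by apply: ge0_ler_powR; rewrite ?nnegrE// ge_min lexx orbT.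
rewrite add0r mulr1; apply: ge0_ler_powR; rewrite ?nnegrE//.
by rewrite ge_min lexx.
Qed.

(** For nonnegative [u], the bound [u t < e]^ p^-1[gives]u t [^ p < e]. It serves twice below: with
    exponent [p] for pointwise limits, and with [p^-1] for the root in the norm. *)
Lemma cvg_powR0 {R : realType} {T : Type} {F : set_system T} {p : R}
    {u : T -> R} :
  Filter F -> 0 < p -> (forall t, 0 <= u t) ->
  u t @[t --> F] --> (0 : R) -> u t `^ p @[t --> F] --> (0 : R).
Proof.
move=> FF p0 u0 /cvgr0Pnorm_lt cu; apply/cvgr0Pnorm_lt => e e0.
apply: filterS (cu (e `^ p^-1) (powR_gt0 _ e0)) => t.
rewrite !ger0_norm ?powR_ge0// => ut.
have -> : e = (e `^ p^-1) `^ p by rewrite -powRrM mulVf ?gt_eqF// powRr1// ltW.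
by rewrite gt0_ltr_powR// nnegrE ?powR_ge0.
Qed.

(** Dominated convergence is applied to the [p]-th powers, which is why [G] bounds [|h n x|^p]
    rather than [|h n x|]. *)
Lemma dominated_cvg_Lnorm0 {R : realType} {d : measure_display}
    {X : measurableType d} {mu : {measure set X -> \bar R}} {p : R}
    {h : nat -> X -> R} {G : X -> R} :
  0 < p -> (forall n, measurable_fun [set: X] (h n)) ->
  {ae mu, forall x, h n x @[n --> \oo] --> (0 : R)} ->
  mu.-integrable [set: X] (fun x => (G x)%:E) ->
  {ae mu, forall x n, `|h n x| `^ p <= G x} ->
  'N[mu]_p%:E[(fun x => (h n x)%:E)]%E @[n --> \oo] --> 0%E.
Proof.
move=> p0 mh h0 iG hG.
have mhp n : measurable_fun [set: X] (fun x => (`|h n x| `^ p)%:E).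
  exact/measurable_EFinP/measurable_norm_powR.
have [|||_ _] := @dominated_convergence _ _ _ mu _ measurableT
  (fun n x => (`|h n x| `^ p)%:E) (cst 0%E) _ mhp _ _ iG.
- exact: measurable_cst.
- apply: filterS h0 => x hx _; apply: cvg_EFin; first exact: nearW.
  apply: cvg_powR0 => //.
  by rewrite -(@normr0 _ R); exact: cvg_norm.
- by apply: filterS hG => x hx n _ /=; rewrite ger0_norm ?powR_ge0// lee_fin.
(* In the extended reals, the integrals tend to 0 when they are eventually finite and their real
   parts tend to 0; both properties pass to the power [p^-1]. *)
rewrite integral0 => /fine_cvgP[fin cvg0].
rewrite unlock; apply/fine_cvgP; split.
  by apply: filterS fin => n; exact: fin_num_poweR.
rewrite /comp; under eq_fun => n do rewrite fine_poweR.
apply: cvg_powR0; [by rewrite invr_gt0| |exact: cvg0] => n.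
by apply: fine_ge0; apply: integral_ge0 => x _; rewrite lee_fin powR_ge0.
Qed.

Theorem proposition4p2 (R : realType) (d : measure_display)
    (X : measurableType d) (mu : {measure set X -> \bar R})
    (p : R) (hp : 1 <= p)
    (f_ : nat -> {mfun X >-> R}) (f : {mfun X >-> R})
    (hf_ : forall n, Lambda mu p (f_ n))
    (hcvg : {ae mu, forall x, f_ n x @[n --> \oo] --> f x})
    (hdom : exists g : {mfun X >-> R}, Lambda mu p g /\
       {ae mu, forall x,
         (ereal_sup [set `|f_ n x|%:E | n in [set: nat]] <= (g x)%:E)%E}) :
  Lambda mu p f /\
  alpha_norm mu p (f_ n \- f) @[n --> \oo] --> 0%E.
Proof.
have p0 : 0 < p by exact: lt_le_trans hp.
have [g [Lg hsup]] := hdom.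
have fg_ : {ae mu, forall x n, `|f_ n x| <= g x}.
  apply: filterS hsup => x hx n; rewrite -lee_fin; apply: le_trans hx.
  by apply: ereal_sup_ubound; exists n.
(* The bound by [g x] is closed, so it passes to the limit in [n]. *)
have fg : {ae mu, forall x, `|f x| <= g x}.
  apply: filterS2 hcvg fg_ => x cx lex.
  by apply: (cvgr_to_le (cvg_norm cx)); exact: nearW.
split.
  apply: Lambda_ae_le Lg => //.
  by apply: filterS fg => x /le_trans -> //; exact: ler_norm.
(* This is the [p]-th power of [2 * min(|g x|, 1)]; the factor 2 comes from
   [|f_n - f| <= |f_n| + |f| <= 2 g]. *)
pose G x := 2 `^ p * Num.min `|g x| 1 `^ p.
apply: (dominated_cvg_Lnorm0 (G := G)) => //.
- move=> n; apply: measurable_minr => //.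
  by apply: measurableT_comp => //; exact: (measurable_funB (f := f_ n)).
- apply: filterS hcvg => x cx.
  have cd : `|f_ n x - f x| @[n --> \oo] --> (0 : R).
    rewrite -(@normr0 _ R) -(subrr (f x)).
    by apply: cvg_norm; apply: cvgB => //; exact: cvg_cst.
  (* The truncated difference lies between 0 and [|f_n x - f x|]. *)
  apply: (squeeze_cvgr _ (cvg_cst 0) cd); apply: nearW => n /=.
  by rewrite le_min normr_ge0 ler01 ge_min lexx.
- under eq_fun => x do rewrite EFinM.
  by apply: integrableZl => //; exact: Lambda_integrable_min1.
- apply: filterS2 fg_ fg => x lex_ lex n.
  have m0 (a : R) : 0 <= Num.min `|a| 1 by rewrite le_min normr_ge0 ler01.
  rewrite /G -powRM// ger0_norm//; apply: ge0_ler_powR; rewrite ?nnegrE ?mulr_ge0 ?(ltW p0)//.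
  (* If [|g x| < 1], the triangle inequality bounds the minimum by [2 |g x|]; otherwise the minimum
     is at most 1, hence at most 2. *)
  have := ler_normB (f_ n x) (f x); have := lex_ n; have := ler_norm (g x).
  rewrite /= /Num.min; case: ifPn; case: ifPn; lra.
Qed.
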